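(* Let $\mathcal C\in\mathbb R^{d\times d}$ be a symmetric positive definite matrix, let $\tau$ be a Borel probability measure on the unit sphere $\mathbb S^{d-1}\subset\mathbb R^d$, and let $\pi_{\mathrm{gH\&R}}$ be the transition kernel (and the associated averaging operator) of the generalized Hit-and-Run sampler with direction distribution $\tau$ and Gaussian target measure $\gamma^{\mathcal C}=\mathcal N(0,\mathcal C)$. Let $$\rho\ =\ \frac12\inf_{|\zeta|=1}\mathbb E_{v\sim\tau}\Bigl(\zeta\cdot\frac{\mathcal C^{-1/2}v}{|\mathcal C^{-1/2}v|}\Bigr)^2$$ (infimum over unit vectors $\zeta\in\mathbb R^d$), and define $\lambda$ by $$1-\lambda\ =\ \sup\bigl\{\|\pi_{\mathrm{gH\&R}}f\|_{L^2(\gamma^{\mathcal C})}\ :\ f\in L^2(\gamma^{\mathcal C}),\ f\perp 1,\ \|f\|_{L^2(\gamma^{\mathcal C})}=1\bigr\}.$$ Then $$\lambda\ \leq\ 3\rho .$$ In particular, any $\rho'>0$ such that $$\boldsymbol{\mathcal W}^2_{\mathcal C^{-1/2}}\bigl(\pi_{\mathrm{gH\&R}}(x,\cdot),\,\pi_{\mathrm{gH\&R}}(\tilde x,\cdot)\bigr)\ \leq\ (1-\rho')\,|x-\tilde x|_{\mathcal C^{-1/2}}\quad\text{for all }x,\tilde x\in\mathbb R^d$$ satisfies $\rho'\leq 3\rho$.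
   Context: For $x\in\mathbb R^d$ and $v\in\mathbb S^{d-1}$, let $\gamma^{\mathcal C}_{x,v}$ be the probability measure on $\mathbb R$ with density proportional to $h\mapsto\gamma^{\mathcal C}(x+hv)$, where $\gamma^{\mathcal C}(\cdot)$ denotes the Lebesgue density of $\mathcal N(0,\mathcal C)$; explicitly $\gamma^{\mathcal C}_{x,v}=\mathcal N\bigl(-\frac{x\cdot\mathcal C^{-1}v}{|\mathcal C^{-1/2}v|^2},\,|\mathcal C^{-1/2}v|^{-2}\bigr)$. The generalized Hit-and-Run kernel is $$\pi_{\mathrm{gH\&R}}(x,A)=\int_{\mathbb S^{d-1}}\int_{\mathbb R}1_A(x+hv)\,\gamma^{\mathcal C}_{x,v}(dh)\,\tau(dv)$$ for measurable $A\subset\mathbb R^d$, and the averaging operator is $\pi_{\mathrm{gH\&R}}f(x)=\int_{\mathbb S^{d-1}}\int_{\mathbb R}f(x+hv)\,\gamma^{\mathcal C}_{x,v}(dh)\,\tau(dv)$. The kernel leaves $\gamma^{\mathcal C}$ invariant (indeed is reversible with respect to it), so the operator is well defined on $L^2(\gamma^{\mathcal C})$. $f\perp1$ means $\int f\,d\gamma^{\mathcal C}=0$. Norms: $|\cdot|$ is the Euclidean norm and $|x|_{\mathcal C^{-1/2}}=|\mathcal C^{-1/2}x|$. $\boldsymbol{\mathcal W}^2_{\mathcal C^{-1/2}}$ is the $L^2$-Wasserstein distance with respect to the metric induced by $|\cdot|_{\mathcal C^{-1/2}}$: $\boldsymbol{\mathcal W}^2_{\mathcal C^{-1/2}}(\eta,\nu)=\inf\bigl(\mathbb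 E|X-\tilde X|^2_{\mathcal C^{-1/2}}\bigr)^{1/2}$ over all couplings $(X,\tilde X)$ of $\eta$ and $\nu$. *)

(* Defs.v *)
From HB Require Import structures.
From mathcomp Require Import all_boot all_order all_algebra.
From mathcomp Require Import all_classical all_reals all_analysis.
From mathcomp Require Import measurable_realfun.

Set Implicit Arguments.
Unset Strict Implicit.
Unset Printing Implicit Defensive.

Import Order.TTheory GRing.Theory Num.Theory.
Import numFieldNormedType.Exports.

Local Open Scope classical_set_scope.
Local Open Scope ring_scope.

(* The library puts no sigma-algebra on matrices: use the Borel one. *)
Definition mx_display : measure_display. Proof. exact: default_measure_display. Qed.

Section borel_matrix.
Context {R : realType} (m n : nat).

HB.instance Definition _ := @isMeasurable.Build mx_display 'M[R]_(m, n)
  <<s (@open 'M[R]_(m, n)) >> (@sigma_algebra0 _ setT _) (@sigma_algebraC _ _)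
  (@sigma_algebra_bigcup _ setT _).

Lemma open_measurable_mx (U : set 'M[R]_(m, n)) : open U -> measurable U.
Proof. exact: sub_sigma_algebra. Qed.

Lemma measurable_coord (i : 'I_m) (j : 'I_n) :
  measurable_fun [set: 'M[R]_(m, n)] (fun M => M i j : R).
Proof.
apply: (measurability _ (RGenOpens.measurableE R)) => _ [_ [a [b ->]] <-].
rewrite setTI; apply: open_measurable_mx.
apply: open_comp; last exact: interval_open.
by move=> M _; exact: coord_continuous.
Qed.

Lemma measurable_fun_mx d (T : measurableType d) (f : T -> 'M[R]_(m, n)) :
  (forall i j, measurable_fun [set: T] (fun t => f t i j : R)) ->
  measurable_fun [set: T] f.
Proof.
move=> mf; apply: (@measurability _ _ _ _ _ _ (@open 'M[R]_(m, n))) => //.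
move=> _ [U oU <-]; rewrite setTI.
pose box (p : 'M[rat]_(m, n) * rat) :=
  [set M : 'M[R]_(m, n) | forall i j, ball (ratr (p.1 i j) : R) (ratr p.2) (M i j)].
pose F (p : 'M[rat]_(m, n) * rat) :=
  if `[< box p `<=` U >] then f @^-1` box p else set0.
suff -> : f @^-1` U = \bigcup_p F p.
  apply: countable_bigcupT_measurable => // p; rewrite /F.
  case: ifP => // _.
  rewrite (_ : _ @^-1` _ = \bigcap_(i in [set: 'I_m]) \bigcap_(j in [set: 'I_n])
      ((fun t => f t i j : R) @^-1` ball (ratr (p.1 i j) : R) (ratr p.2))); last first.
    by apply/seteqP; split => t /= H => [i _ j _|i j]; exact: H.
  apply: fin_bigcap_measurable => // i _.
  apply: fin_bigcap_measurable => // j _.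
  rewrite -[X in measurable X]setTI; apply: mf => //; exact: measurable_ball.
apply/seteqP; split => t; last first.
  by move=> [p _]; rewrite /F; case: ifPn => // /asboolP pU /pU.
move=> /= Uft; have /nbhs_ballP[e /= e0 eU] : nbhs (f t) U by exact: open_nbhs_nbhs.
have /rat_in_itvoo[r] : 0 < e / 2 by rewrite divr_gt0.
rewrite in_itv/= => /andP[r0 re].
have /choice[q' q'P] (ij : 'I_m * 'I_n) :
    exists q : rat, `|ratr q - f t ij.1 ij.2| < ratr r.
  have /rat_in_itvoo[q] : f t ij.1 ij.2 - ratr r < f t ij.1 ij.2 + ratr r.
    by rewrite ltrBlDr -addrA ltrDl addr_gt0.
  by rewrite in_itv/= -ltr_distl => ?; exists q.
pose q := \matrix_(i, j) q' (i, j).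
have ftq : box (q, r) (f t) by move=> i j; rewrite /ball/= mxE; exact: (q'P (i, j)).
exists (q, r) => //; rewrite /F asboolT// => M Mq; apply: eU.
split=> // i j; rewrite /ball/= (le_lt_trans (ler_distD (ratr (q i j)) _ _))//.
rewrite [ltRHS](splitr e) ltrD//.
  by rewrite distrC (lt_trans _ re)//; exact: ftq.
by rewrite (lt_trans _ re)//; exact: Mq.
Qed.

End borel_matrix.

Section linear_algebra.
Context {R : realType} {d : nat}.
Implicit Types (x y : 'cV[R]_d) (A B : 'M[R]_d).

(* The library's norm `|x| on 'cV[R]_d is the sup norm, hence [enorm]. *)
Definition dotp x y : R := \sum_(i < d) x i 0 * y i 0.
Definition enorm x : R := Num.sqrt (dotp x x).

(* Borel probabilities on the sphere are represented below as probabilities on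
   'cV[R]_d giving mass 1 to this closed set. *)
Definition usphere : set 'cV[R]_d := [set v | enorm v = 1].

Definition spdmx A : Prop :=
  A^T = A /\ forall x, x != 0 -> 0 < dotp x (A *m x).

(* A^(1/2): the unique symmetric positive definite B with B^2 = A, for A
   symmetric positive definite; junk value 0 otherwise. *)
Definition sqrtmx A : 'M[R]_d := xget 0 [set B | spdmx B /\ B *m B = A].
Definition isqrtmx A : 'M[R]_d := invmx (sqrtmx A).

End linear_algebra.
Arguments usphere : clear implicits.

Section gaussian.
Context {R : realType}.

Definition cons_cV d (p : measurableTypeR R * 'cV[R]_d) : 'cV[R]_d.+1 :=
  col_mx p.1%:M p.2.

Lemma measurable_cons_cV d :
  measurable_fun [set: measurableTypeR R * 'cV[R]_d] (@cons_cV d).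
Proof.
apply: measurable_fun_mx => i j; rewrite /cons_cV; move: i j.
rewrite -[d.+1]/(1 + d)%N => i j; rewrite (ord1 j).
case: (split_ordP i) => k ->.
  under eq_fun do rewrite col_mxEu (ord1 k) mxE eqxx mulr1n.
  exact: measurable_fst.
under eq_fun do rewrite col_mxEd.
exact: (measurableT_comp (measurable_coord k 0) measurable_snd).
Qed.

HB.instance Definition _ d :=
  isMeasurableFun.Build _ _ _ _ (@cons_cV d) (@measurable_cons_cV d).

Lemma measurable_mulmx m n (M : 'M[R]_(m, n)) :
  measurable_fun [set: 'cV[R]_n] (mulmx M).
Proof.
apply: measurable_fun_mx => i j; under eq_fun do rewrite mxE.
by apply: measurable_sum => k; apply: measurable_funM => //;
  exact: measurable_coord.
Qed.

HB.instance Definition _ m n (M : 'M[R]_(m, n)) :=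
  isMeasurableFun.Build _ _ _ _ (mulmx M : 'cV[R]_n -> 'cV[R]_m)
    (measurable_mulmx M).

(* N(0, I_d), the product of d copies of N(0, 1). *)
Fixpoint std_gaussian d : probability 'cV[R]_d R :=
  match d with
  | 0 => \d_(0 : 'cV[R]_0)
  | d.+1 => distribution (normal_prob 0 1 \x std_gaussian d)%E (@cons_cV d)
  end.

(* N(0, C), the law of C^(1/2) Z with Z of law N(0, I_d). *)
Definition gaussian d (C : 'M[R]_d) : probability 'cV[R]_d R :=
  distribution (std_gaussian d) (mulmx (sqrtmx C) : 'cV[R]_d -> 'cV[R]_d).

End gaussian.

Section hit_and_run.
Context {R : realType} {d : nat}.
Variables (C : 'M[R]_d) (tau : probability 'cV[R]_d R).
Implicit Types (x v : 'cV[R]_d) (f : 'cV[R]_d -> R).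
Local Open Scope ereal_scope.

(* The law with density proportional to
   h |-> exp (- (x + h v) . C^-1 (x + h v) / 2): complete the square.
   The second argument of [normal_prob] is the standard deviation. *)
Definition line_gaussian x v : probability (measurableTypeR R) R :=
  normal_prob (- (dotp x (invmx C *m v) / enorm (isqrtmx C *m v) ^+ 2))%R
              (enorm (isqrtmx C *m v))^-1%R.

Definition ghr_kernel x (A : set 'cV[R]_d) : \bar R :=
  \int[tau]_(v in usphere R d) \int[line_gaussian x v]_h
    (\1_A (x + h *: v)%R)%:E.

(* Extended-real valued: for f in L^2(N(0, C)) the integrals are finite for
   almost every x only. *)
Definition ghr_op f x : \bar R :=
  \int[tau]_(v in usphere R d) \int[line_gaussian x v]_h
    (f (x + h *: v)%R)%:E.

Definition rho : \bar R :=
  2^-1%:E * ereal_inf [set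
    'E_tau[fun v => (dotp zeta
      ((enorm (isqrtmx C *m v))^-1 *: (isqrtmx C *m v)) ^+ 2)%R]
    | zeta in usphere R d].

Definition lambda : \bar R :=
  1 - ereal_sup [set 'N[gaussian C]_2%:E[ghr_op f] | f in
    [set f | [/\ f \in Lfun (gaussian C) 2%:E,
                 \int[gaussian C]_x (f x)%:E = 0 &
                 'N[gaussian C]_2%:E[EFin \o f] = 1]]].

End hit_and_run.

Section wasserstein.
Context {R : realType} {d : nat}.
Local Open Scope ereal_scope.
Implicit Types (eta nu : set 'cV[R]_d -> \bar R) (M : 'M[R]_d).

Definition coupling eta nu : set (probability ('cV[R]_d * 'cV[R]_d)%type R) :=
  [set P | forall A, measurable A ->
    P (fst @^-1` A) = eta A /\ P (snd @^-1` A) = nu A].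

(* L^2-Wasserstein distance for the metric |M (x - y)|. *)
Definition wasserstein2 M eta nu : \bar R :=
  ereal_inf [set 'E_P[fun p => (enorm (M *m (p.1 - p.2)) ^+ 2)%R]
            | P in coupling eta nu] `^ 2^-1.

End wasserstein.

(* Main.v *)
(* In the coordinates y = C^(-1/2) x, with u the unit vector along C^(-1/2) v,
   one step of the sampler replaces the component y . u by an independent
   standard normal variable. Hence linear functions are mapped to linear
   functions: pi (zeta . y) = b . y with b = zeta - E[(zeta . u) u], and for a
   unit vector zeta
     |b| >= b . zeta = 1 - E(zeta . u)^2.
   The test function zeta . y, normalized in L^2, gives 1 - lambda >= |b|.
   Coupling pi(C^(1/2) zeta, .) with pi(0, .), Jensen's inequality for the linear
   function zeta . y gives a W^2 distance at least b . zeta. So lambda and rho'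
   are both at most E(zeta . u)^2 for every unit zeta, that is, at most 2 rho. *)
Require Import Defs.
From HB Require Import structures.
From mathcomp Require Import all_boot all_order all_algebra.
From mathcomp Require Import spectral complex ring lra.
From mathcomp Require Import all_classical all_reals all_analysis.
From mathcomp Require Import measurable_realfun.

Set Implicit Arguments.
Unset Strict Implicit.
Unset Printing Implicit Defensive.

Import Order.TTheory GRing.Theory Num.Theory.
Import numFieldNormedType.Exports.

Local Open Scope classical_set_scope.
Local Open Scope ring_scope.

(** * Square roots of positive definite matrices *)

(** Induction on the nodes. This turns functions of the spectrum, here a root, into polynomials,
    which can be evaluated at a matrix. *)
Lemma interpolation (F : fieldType) (g : F -> F) (s : seq F) :
  exists p : {poly F}, forall x, x \in s -> p.[x] = g x.
Proof.
elim: s => [|a s [p ps]]; first by exists 0.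
have [as_|as_] := boolP (a \in s).
  by exists p => x; rewrite inE => /predU1P[->|]; exact: ps.
have [w w0] : exists w : {poly F}, forall x, (w.[x] == 0) = (x \in s).
  by exists (\prod_(y <- s) ('X - y%:P)) => x; rewrite -root_prod_XsubC.
(* Newton's correction: [w] vanishes exactly on the old nodes, so adding a multiple of it repairs
   the value at [a] only. *)
exists (p + ((g a - p.[a]) / w.[a]) *: w) => x; rewrite inE !hornerE.
move=> /predU1P[->|xs]; first by rewrite divfK ?w0// addrC subrK.
have /eqP wx : w.[x] == 0 by rewrite w0.
by rewrite wx mulr0 addr0 ps.
Qed.

(** * The Euclidean inner product *)

Section dotp.
Context {R : realType} {d : nat}.
Implicit Types (x y z : 'cV[R]_d) (A : 'M[R]_d).

Lemma dotpE x y : dotp x y = (x^T *m y) 0 0.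
Proof. by rewrite mxE; apply: eq_bigr => i _; rewrite mxE. Qed.

Lemma dotpC x y : dotp x y = dotp y x.
Proof. by apply: eq_bigr => i _; rewrite mulrC. Qed.

Lemma dotpDr x y z : dotp x (y + z) = dotp x y + dotp x z.
Proof. by rewrite !dotpE mulmxDr mxE. Qed.

Lemma dotpBr x y z : dotp x (y - z) = dotp x y - dotp x z.
Proof. by rewrite !dotpE mulmxBr !mxE. Qed.

Lemma dotpZr a x y : dotp x (a *: y) = a * dotp x y.
Proof. by rewrite !dotpE -scalemxAr mxE. Qed.

Lemma dotpZl a x y : dotp (a *: x) y = a * dotp x y.
Proof. by rewrite dotpC dotpZr dotpC. Qed.

Lemma dotp_mul A x y : dotp x (A *m y) = dotp (A^T *m x) y.
Proof. by rewrite !dotpE trmx_mul trmxK mulmxA. Qed.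

Lemma dotp_ge0 x : 0 <= dotp x x.
Proof. by apply: sumr_ge0 => i _; rewrite -expr2 sqr_ge0. Qed.

Lemma dotp_eq0 x : (dotp x x == 0) = (x == 0).
Proof.
apply/eqP/eqP => [|->]; last by rewrite dotpE mulmx0 mxE.
move/psumr_eq0P => xx; apply/matrixP => i j; rewrite ord1 mxE.
by apply/eqP; rewrite -sqrf_eq0 expr2 xx// => k _; rewrite -expr2 sqr_ge0.
Qed.

Lemma dotp_gt0 x : (0 < dotp x x) = (x != 0).
Proof. by rewrite lt_neqAle dotp_ge0 andbT eq_sym dotp_eq0. Qed.

Lemma sqr_enorm x : enorm x ^+ 2 = dotp x x.
Proof. by rewrite sqr_sqrtr ?dotp_ge0. Qed.

Lemma enorm_ge0 x : 0 <= enorm x.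
Proof. exact: sqrtr_ge0. Qed.

Lemma enorm_eq0 x : (enorm x == 0) = (x == 0).
Proof. by rewrite -sqrf_eq0 sqr_enorm dotp_eq0. Qed.

(** The square of [(x.x) y - (x.y) x] is [(x.x) ((x.x) (y.y) - (x.y)^2)], and [x.x] can be divided
    out when [x] is nonzero. *)
Lemma CauchySchwarz_dotp x y : dotp x y ^+ 2 <= dotp x x * dotp y y.
Proof.
have [->|x0] := eqVneq x 0.
  by rewrite dotpC !dotpE mulmx0 trmx0 mul0mx mxE mul0r expr0n.
have xx : 0 < dotp x x by rewrite dotp_gt0.
have := dotp_ge0 (dotp x x *: y - dotp x y *: x).
rewrite dotpBr !dotpZr ![dotp (_ - _) _]dotpC !dotpBr !dotpZr.
rewrite ![dotp y x]dotpC => H.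
rewrite -subr_ge0 -(pmulr_rge0 _ xx); apply: le_trans H _.
by rewrite le_eqVlt; apply/orP; left; apply/eqP; ring.
Qed.

End dotp.

(** * Existence of the positive definite square root *)

Section sqrtmx.
Context {R : realType}.
Local Open Scope complex_scope.

Lemma trmx_horner_mx d (A : 'M[R]_d.+1) (p : {poly R}) :
  A^T = A -> (horner_mx A p)^T = horner_mx A p.
Proof.
move=> As; elim/poly_ind: p => [|p c IH].
  by rewrite rmorph0 trmx0.
rewrite rmorphD rmorphM /= horner_mx_X horner_mx_C linearD/= tr_scalar_mx.
congr (_ + _); rewrite -mulmxE trmx_mul As IH.
exact: (comm_mx_horner p (erefl : comm_mx A A)).
Qed.

Lemma spd_eigenvalue_gt0 d (A : 'M[R]_d.+1) a :
  spdmx A -> eigenvalue A a -> 0 < a.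
Proof.
move=> [As Apos] /eigenvalueP[v vA v0].
have vT0 : v^T != 0 by apply: contra_neq v0 => vT; rewrite -[v]trmxK vT trmx0.
have := Apos _ vT0; rewrite -As -trmx_mul vA linearZ/= dotpZr.
by rewrite pmulr_lgt0// dotp_gt0.
Qed.

(** A real symmetric matrix is Hermitian over [R[i]], so it is diagonalizable there with real
    eigenvalues. Only the diagonal descends to [R]; [P] stays complex, which is harmless for
    identities between polynomials in [A]. *)
Lemma real_spectral d (A : 'M[R]_d.+1) : A^T = A ->
  exists (P : 'M[R[i]]_d.+1) (D : 'rV[R]_d.+1), [/\ P \in unitmx,
    map_mx (real_complex R) A =
      invmx P *m diag_mx (map_mx (real_complex R) D) *m P &
    forall i, eigenvalue A (D 0 i)].
Proof.
move=> As; set B := map_mx _ A.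
have Bh : B \is hermsymmx.
  apply: realsym_hermsym.
    apply/is_hermitianmxP; rewrite expr0 scale1r map_mx_id//.
    by rewrite /B map_trmx As.
  apply/mxOverP => i j; by rewrite mxE complex_real.
have /hermitian_normalmx /orthomx_spectralP := Bh.
have := hermitian_spectral_diag_real Bh.
have := spectral_unit B.
move: (spectralmx B) (spectral_diag B) => P D0 Pu /mxOverP D0r BE.
pose D : 'rV[R]_d.+1 := map_mx (@complex.Re R) D0.
have DE : D0 = map_mx (real_complex R) D.
  apply/matrixP => i j; rewrite !mxE; apply/esym/RRe_real.
  exact: D0r.
exists P, D; split; rewrite -?DE// => i.
(* Over [R[i]], row [i] of [P] is a left eigenvector; it is nonzero because [P] is invertible. *)
rewrite -(eigenvalue_map (real_complex R)) -/B.
apply/eigenvalueP; exists (row i P).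
  rewrite -row_mul BE !mulmxA mulmxV// mul1mx row_mul.
  by rewrite row_diag_mx -scalemxAl -rowE DE !mxE.
apply: contraTneq Pu => Pi0; rewrite -row_free_unit.
apply/negP => /row_freeP[Q PQ].
have := congr1 (row i) PQ; rewrite row_mul Pi0 mul0mx row1.
by move/matrixP/(_ 0 i); rewrite !mxE !eqxx => /esym/eqP; rewrite oner_eq0.
Qed.

(** The root is a polynomial in [A]. Taking [Q = r(A)] with [r] a fourth root on the spectrum, [Q]
    is symmetric and [B = Q * Q] satisfies [x.Bx = |Qx|^2], so positivity comes with the
    construction. *)
Lemma spd_sqrt_exists d (A : 'M[R]_d) : spdmx A ->
  exists B, spdmx B /\ B *m B = A.
Proof.
case: d A => [|d] A [As Apos].
  exists A; split => //; by apply/matrixP => -[].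
have [P [D [Pu AE Deig]]] := real_spectral As.
have D0 i : 0 < D 0 i by apply: spd_eigenvalue_gt0 (Deig i).
have [r rD] := interpolation (fun a => Num.sqrt (Num.sqrt a))
  [seq D 0 i | i : 'I_d.+1].
have AEr : horner_mx A (r * r * (r * r)) = A.
  (* The identity [r(A)^4 = A] is checked after embedding in [R[i]], where it reduces to the
     diagonal entries. *)
  apply: (map_mx_inj (f := real_complex R)).
  rewrite map_horner_mx AE horner_mx_uconjC// horner_mx_diag.
  congr (_ *m diag_mx _ *m _); apply/rowP => i; rewrite !mxE horner_map/=.
  rewrite !hornerM rD ?map_f ?mem_enum// -!expr2 !sqr_sqrtr ?sqrtr_ge0//.
  exact: ltW.
have rs := trmx_horner_mx r As.
move: AEr; rewrite !rmorphM/=; set Q := horner_mx A r in rs * => QA.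
exists (Q * Q); split => //; split.
  by rewrite -mulmxE trmx_mul rs.
move=> x x0; rewrite -mulmxE -mulmxA dotp_mul rs dotp_gt0.
(* If [Qx = 0], then [Ax = Q^4 x = 0], against the positivity of [A]. *)
apply: contraTneq (Apos _ x0) => Qx0.
by rewrite -QA -!mulmxE -!mulmxA Qx0 !mulmx0 dotpE mulmx0 mxE ltxx.
Qed.

End sqrtmx.

(** * One-dimensional normal laws *)

Lemma integral_cst_probability d (T : measurableType d) (R : realType)
  (P : probability T R) (c : R) : (\int[P]_x c%:E = c%:E)%E.
Proof. by rewrite integral_cst// [X in (_ * X)%E]probability_setT mule1. Qed.

Section normal.
Context {R : realType}.
Local Notation mu := (@lebesgue_measure R).

Definition affine (m s : R) (z : measurableTypeR R) : measurableTypeR R :=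
  m + s * z.

Lemma measurable_affine m s : measurable_fun setT (affine m s).
Proof. by apply: measurable_funD => //; apply: measurable_funM. Qed.

HB.instance Definition _ m s :=
  isMeasurableFun.Build _ _ _ _ (affine m s) (@measurable_affine m s).

Lemma preimage_affine m s a b : 0 < s ->
   affine m s @^-1` `]a, b] = `](a - m) / s, (b - m) / s]%classic.
Proof.
move=> s0; apply/seteqP; split => z /=; rewrite !in_itv/= /affine;
  by rewrite ltr_pdivrMr// ler_pdivlMr// ltrBlDl lerBrDl [z * s]mulrC.
Qed.

(** The rescaled image measure gives half-open intervals their length, so uniqueness of Lebesgue
    measure identifies it. *)
Lemma lebesgue_measure_affine m s (s0 : 0 < s) (A : set R) : measurable A ->
  mu A = (s%:E * mu (affine m s @^-1` A))%E.
Proof.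
pose sn := NngNum (ltW s0).
move=> mA.
rewrite (@lebesgue_measure_unique R (mscale sn (pushforward mu (affine m s))))//.
move=> _ [[a b] _ <-]/=; rewrite /mscale/= /pushforward preimage_affine//.
rewrite !lebesgue_measure_itv/= !lte_fin ltr_pM2r ?invr_gt0// ltrD2r.
case: ifPn => _; last by rewrite mule0.
rewrite -!EFinB -EFinM; congr EFin; field.
by rewrite gt_eqF.
Qed.

Lemma normal_pdf_affine m s z : 0 < s ->
  s * normal_pdf m s (affine m s z) = normal_pdf 0 1 z.
Proof.
move=> s0; rewrite !normal_pdfE ?gt_eqF//= /normal_peak /normal_fun /affine.
rewrite mulrA expr1n mul1r; congr (_ * expR _).
  rewrite -mulrnAr sqrtrM ?sqr_ge0// sqrtr_sqr gtr0_norm//.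
  by rewrite invfM mulrA divff ?mul1r// gt_eqF.
by field; rewrite gt_eqF.
Qed.

(** The Jacobian [s] cancels against the normalizing factor of the density. Every computation on a
    line is thereby reduced to N(0, 1). *)
Lemma normal_prob_affine m s (s0 : 0 < s) (A : set (measurableTypeR R)) :
  measurable A ->
  normal_prob m s A = distribution (normal_prob 0 1) (affine m s) A.
Proof.
move=> mA; rewrite /distribution /pushforward /normal_prob.
pose sn := NngNum (ltW s0).
rewrite (eq_measure_integral (mscale sn (pushforward mu (affine m s)))); last first.
  by move=> B mB _; exact: lebesgue_measure_affine.
rewrite ge0_integral_mscale//=; last 2 first.
- by apply/measurable_EFinP/measurable_funTS; exact: measurable_normal_pdf.
- by move=> x _; rewrite lee_fin normal_pdf_ge0.
rewrite ge0_integral_pushforward//=; last 2 first.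
- by apply/measurable_EFinP/measurable_funTS; exact: measurable_normal_pdf.
- by move=> x _; rewrite lee_fin normal_pdf_ge0.
rewrite -ge0_integralZl//=; last 4 first.
- by rewrite -[X in measurable X]setTI; exact: measurable_affine.
- apply/measurable_EFinP/measurable_funTS.
  by apply: measurableT_comp => //; exact: measurable_normal_pdf.
- by move=> x _; rewrite lee_fin normal_pdf_ge0.
- by rewrite lee_fin ltW.
by apply: eq_integral => z _; rewrite /= -EFinM normal_pdf_affine.
Qed.

Lemma normal_prob_opp (A : set (measurableTypeR R)) : measurable A ->
  normal_prob 0 1 A = distribution (normal_prob 0 1) (affine 0 (-1)) A.
Proof.
move=> mA; rewrite /distribution /pushforward /normal_prob.
have oppE : affine 0 (-1) = -%R by apply/funext => z; rewrite /affine add0r mulN1r.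
rewrite (eq_measure_integral (pushforward mu (affine 0 (-1)))); last first.
  by move=> B mB _; rewrite /= oppE lebesgue_measureN.
rewrite ge0_integral_pushforward//=; last 2 first.
- by apply/measurable_EFinP/measurable_funTS; exact: measurable_normal_pdf.
- by move=> x _; rewrite lee_fin normal_pdf_ge0.
apply: eq_integral => z _ /=; rewrite !normal_pdfE ?oner_eq0// oppE.
by rewrite /normal_fun !subr0 sqrrN.
Qed.

(** The Radon-Nikodym derivative and [normal_pdf] have the same integral over every measurable set,
    hence agree almost everywhere. *)
Lemma ge0_integral_normal_prob m s (f : R -> \bar R) :
  measurable_fun setT f -> (forall x, 0 <= f x)%E ->
  (\int[normal_prob m s]_x f x = \int[mu]_x (f x * (normal_pdf m s x)%:E))%E.
Proof.
move=> mf f0.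
have dom := normal_prob_dominates m s.
rewrite -(Radon_Nikodym_SigmaFinite.change_of_variables dom f0)//.
apply: ae_eq_integral => //.
- apply: emeasurable_funM => //.
  exact: measurable_int (Radon_Nikodym_SigmaFinite.f_integrable dom).
- apply: emeasurable_funM => //; apply/measurable_EFinP.
  exact: measurable_normal_pdf.
apply: ae_eqe_mul2l; apply: integral_ae_eq => //.
- exact: Radon_Nikodym_SigmaFinite.f_integrable.
- by apply/measurable_EFinP; exact: measurable_normal_pdf.
- by move=> E _ mE; rewrite -Radon_Nikodym_SigmaFinite.f_integral.
Qed.

(* [t <= exp t] at [t = x^2/4] turns [x^2] times the density of N(0,1) into a
   multiple of the density of N(0,2). *)
Lemma normal_second_moment_lty :
  (\int[normal_prob 0 1]_(x in [set: measurableTypeR R]) (x ^+ 2)%:E < +oo)%E.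
Proof.
(* The 4 comes from [x^2 = 4 (x^2/4)]; the quotient exchanges the normalizing constants of N(0, 1)
   and N(0, 2). *)
pose K : R := 4 * normal_peak 1 / normal_peak (Num.sqrt 2).
have r2 : Num.sqrt 2 != 0 :> R by rewrite sqrtr_eq0 -ltNge ltr0n.
have p2 := normal_peak_gt0 r2.
have K0 : 0 <= K.
  by rewrite mulr_ge0 ?mulr_ge0 ?invr_ge0 ?normal_peak_ge0.
rewrite ge0_integral_normal_prob//; last 2 first.
- by apply/measurable_EFinP; exact: measurable_funX.
- by move=> x; rewrite lee_fin sqr_ge0.
apply: (@le_lt_trans _ _ (\int[mu]_x (K%:E * (normal_pdf 0 (Num.sqrt 2) x)%:E))%E).
  apply: ge0_le_integral => //.
  - by move=> x _; rewrite -EFinM lee_fin mulr_ge0 ?sqr_ge0 ?normal_pdf_ge0.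
  - apply/measurable_EFinP/measurable_funM; first exact: measurable_funX.
    exact: measurable_normal_pdf.
  - apply/measurable_EFinP/measurable_funM => //; exact: measurable_normal_pdf.
  move=> x _; rewrite -!EFinM lee_fin !normal_pdfE ?oner_eq0// /normal_fun.
  rewrite [K * _]mulrA divfK ?gt_eqF// subr0 expr1n sqr_sqrtr// mulrCA.
  rewrite [4 * _]mulrC -[leRHS]mulrA.
  rewrite ler_pM2l ?normal_peak_gt0 ?oner_eq0//.
  have -> : - x ^+ 2 / (2 *+ 2) = x ^+ 2 / 4 + - x ^+ 2 / (1 *+ 2) by field.
  rewrite expRD mulrA ler_pM2r ?expR_gt0//.
  have := expR_ge1Dx (x ^+ 2 / 4); lra.
rewrite ge0_integralZl//; last 2 first.
- by apply/measurable_EFinP; exact: measurable_normal_pdf.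
- by move=> x _; rewrite lee_fin normal_pdf_ge0.
by rewrite integral_normal_pdf mule1 ltry.
Qed.


(* Equal to 1, but only finiteness and positivity matter here. *)
Definition normal_var : R :=
  fine (\int[normal_prob 0 1]_(x in [set: measurableTypeR R]) (x ^+ 2)%:E)%E.

Lemma normal_varE :
  (\int[normal_prob 0 1]_(x in [set: measurableTypeR R]) (x ^+ 2)%:E)%E =
  normal_var%:E.
Proof.
rewrite fineK// ge0_fin_numE ?normal_second_moment_lty//.
by apply: integral_ge0 => x _; rewrite lee_fin sqr_ge0.
Qed.

(** A zero second moment would concentrate N(0, 1) on the origin, a Lebesgue-null point, hence also
    a null set for N(0, 1). *)
Lemma normal_var_gt0 : 0 < normal_var.
Proof.
rewrite -lte_fin -normal_varE lt_neqAle integral_ge0 ?andbT; last first.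
  by move=> x _; rewrite lee_fin sqr_ge0.
apply/negP => /eqP/esym v0.
have : ae_eq (normal_prob 0 1) setT
    (fun x : measurableTypeR R => (x ^+ 2)%:E) (cst 0%E).
  apply/ae_eq_integral_abs => //.
    by apply/measurable_EFinP; exact: measurable_funX.
  by under eq_integral do rewrite gee0_abs ?lee_fin ?sqr_ge0//.
case=> N [mN N0 sN].
have m1 : measurable [set (0 : measurableTypeR R)] by exact: measurable_set1.
have : normal_prob 0 1 (N `|` [set (0 : R)]) = 0%E.
  rewrite measureU0//.
  have /null_content_dominatesP := normal_prob_dominates (0 : R) 1; apply => //.
  exact: lebesgue_measure_set1.
have -> : N `|` [set 0] = setT.
  apply/seteqP; split => // x _.
  have [->|x0] := eqVneq x 0; [by right | left; apply: sN => /= /(_ I)].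
  by move=> [] /eqP; rewrite sqrf_eq0 (negbTE x0).
rewrite probability_setT => /eqP; by rewrite onee_eq0.
Qed.

Lemma normal_integrable_id :
  (normal_prob 0 1).-integrable [set: measurableTypeR R] EFin.
Proof.
apply/integrableP; split => //.
apply: (@le_lt_trans _ _ (\int[normal_prob 0 1]_(x in [set: measurableTypeR R])
  (1 + (x ^+ 2)%:E))%E).
  apply: ge0_le_integral => //.
  - by apply: measurableT_comp.
  - by apply/measurable_EFinP/measurable_funD => //; exact: measurable_funX.
  - move=> x _; rewrite /= lee_fin.
    have [x0|x0] := ger0P x; nra.
rewrite ge0_integralD//=; last 2 first.
- by move=> x _; rewrite lee_fin sqr_ge0.
- by apply/measurable_EFinP; exact: measurable_funX.
by rewrite integral_cst_probability lte_add_pinfty ?ltry// normal_second_moment_lty.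
Qed.

(** By the symmetry of N(0, 1), the mean equals its own opposite; being finite, it vanishes. *)
Lemma normal_mean0 :
  (\int[normal_prob 0 1]_(x in [set: measurableTypeR R]) x%:E = 0)%E.
Proof.
have : (\int[normal_prob 0 1]_(x in [set: measurableTypeR R]) x%:E =
  - \int[normal_prob 0 1]_(x in [set: measurableTypeR R]) x%:E)%E.
  rewrite [LHS](eq_measure_integral
    (distribution (normal_prob 0 1) (affine 0 (-1)))); last first.
    by move=> A mA _; exact: normal_prob_opp.
  rewrite integral_distribution//; last first.
    apply: eq_integrable (integrableN normal_integrable_id) => //.
    by move=> x _; rewrite /= /affine add0r mulN1r EFinN.
  rewrite -integralN; last exact: integrable_add_def normal_integrable_id.
  by apply: eq_integral => x _; rewrite /= /affine add0r mulN1r EFinN.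
have /fineK <- : (\int[normal_prob 0 1]_(x in [set: measurableTypeR R]) x%:E)%E
  \is a fin_num by exact: integrable_fin_num normal_integrable_id.
by rewrite -EFinN => -[] ?; congr EFin; lra.
Qed.

Lemma normal_integral_linear (a c : R) :
  (\int[normal_prob 0 1]_(x in [set: measurableTypeR R]) (a * x + c)%:E = c%:E)%E.
Proof.
under eq_integral do rewrite EFinD EFinM.
rewrite integralD//; last 2 first.
- exact: integrableZl normal_integrable_id.
- by apply: finite_measure_integrable_cst.
rewrite integralZl//; last exact: normal_integrable_id.
by rewrite normal_mean0 mule0 add0e integral_cst_probability.
Qed.

Lemma normal_integral_sqr (a c : R) :
  (\int[normal_prob 0 1]_(x in [set: measurableTypeR R]) ((a * x + c) ^+ 2)%:E =
   (a ^+ 2 * normal_var + c ^+ 2)%:E)%E.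
Proof.
have i2 : (normal_prob 0 1).-integrable [set: measurableTypeR R]
    (fun x => (x ^+ 2)%:E).
  apply/integrableP; split.
    by apply/measurable_EFinP; exact: measurable_funX.
  under eq_integral do rewrite gee0_abs ?lee_fin ?sqr_ge0//.
  exact: normal_second_moment_lty.
rewrite (eq_integral (fun x : measurableTypeR R =>
  ((a ^+ 2)%:E * (x ^+ 2)%:E + ((2 * a * c) * x + c ^+ 2)%:E)%E)); last first.
  by move=> x _; rewrite -EFinM -EFinD; congr EFin; ring.
have il : (normal_prob 0 1).-integrable [set: measurableTypeR R]
    (fun x => ((2 * a * c) * x + c ^+ 2)%:E).
  under eq_fun do rewrite EFinD EFinM.
  apply: integrableD => //.
    exact: integrableZl normal_integrable_id.
  exact: finite_measure_integrable_cst.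
rewrite integralD//; last exact: integrableZl.
by rewrite integralZl// normal_varE normal_integral_linear -EFinM -EFinD.
Qed.

Lemma integral_normal_prob_linear (m s a c : R) : 0 < s ->
  (\int[normal_prob m s]_(x in [set: measurableTypeR R]) (a * x + c)%:E =
   (a * m + c)%:E)%E.
Proof.
move=> s0; rewrite (eq_measure_integral
    (distribution (normal_prob 0 1) (affine m s))); last first.
  by move=> A mA _; exact: normal_prob_affine.
rewrite integral_distribution//=; last 2 first.
- by apply/measurable_EFinP/measurable_funD => //; exact: measurable_funM.
- apply: (eq_integrable _ (fun x : measurableTypeR R =>
    ((a * s)%:E * x%:E + (a * m + c)%:E)%E)) => //.
    by move=> x _; rewrite /= /affine -EFinM -EFinD; congr EFin; ring.
  apply: integrableD => //; first exact: integrableZl normal_integrable_id.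
  exact: finite_measure_integrable_cst.
rewrite -(normal_integral_linear (a * s)); apply: eq_integral => x _.
by rewrite /= /affine; congr EFin; ring.
Qed.

End normal.

(** * Moments of the standard Gaussian vector *)

Section measurable_dotp.
Context {R : realType} {d : nat} {disp} {T : measurableType disp}.
Implicit Types f g : T -> 'cV[R]_d.

Lemma measurable_fun_coord f i : measurable_fun setT f ->
  measurable_fun setT (fun t => f t i 0 : R).
Proof. exact: (measurableT_comp (measurable_coord i 0)). Qed.

Lemma measurable_fun_dotp f g : measurable_fun setT f -> measurable_fun setT g ->
  measurable_fun setT (fun t => dotp (f t) (g t)).
Proof.
move=> mf mg; apply: measurable_sum => i.
by apply: measurable_funM; exact: measurable_fun_coord.
Qed.

Lemma measurable_fun_enorm f : measurable_fun setT f ->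
  measurable_fun setT (fun t => enorm (f t)).
Proof.
move=> mf; have ms : measurable_fun setT (@Num.sqrt R).
  by apply: continuous_measurable_fun; exact: sqrt_continuous.
exact: (measurableT_comp ms (measurable_fun_dotp mf mf)).
Qed.

Lemma measurable_fun_mulmx (A : 'M[R]_d) f : measurable_fun setT f ->
  measurable_fun setT (fun t => A *m f t).
Proof. exact: (measurableT_comp (measurable_mulmx A)). Qed.

Lemma measurable_fun_scalemx (h : T -> R) f : measurable_fun setT h ->
  measurable_fun setT f -> measurable_fun setT (fun t => h t *: f t).
Proof.
move=> mh mf; apply: measurable_fun_mx => i j; rewrite (ord1 j).
under eq_fun do rewrite mxE.
by apply: measurable_funM => //; exact: measurable_fun_coord.
Qed.

Lemma measurable_fun_addmx f g : measurable_fun setT f -> measurable_fun setT g ->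
  measurable_fun setT (fun t => f t + g t).
Proof.
move=> mf mg; apply: measurable_fun_mx => i j; rewrite (ord1 j).
under eq_fun do rewrite mxE.
by apply: measurable_funD; exact: measurable_fun_coord.
Qed.

End measurable_dotp.

(** The inverse is continuous only away from 0, so that point is split off as a measurable
    singleton. *)
Lemma measurable_invr (R : realType) : measurable_fun setT (@GRing.inv R).
Proof.
rewrite (_ : setT = [set (0 : R)] `|` ~` [set (0 : R)]); last by rewrite setUv.
apply/measurable_funU => //; first by apply: measurableC.
split; first by apply: measurable_fun_set1.
apply: open_continuous_measurable_fun.
  by apply: closed_openC; exact: closed_eq.
by move=> x; rewrite inE/= => /eqP x0; exact: inv_continuous.
Qed.

(** * Linear forms of a standard Gaussian vector *)

Section std_gaussian.
Context {R : realType}.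
Local Notation sig2 := (@normal_var R).

(** Induction on [d] by Fubini. The shift [c] is what makes the induction close: for the remaining
    coordinates, the term of the first coordinate is a constant. *)
Lemma integral_std_gaussian_sqr d (a : 'cV[R]_d) (c : R) :
  (\int[std_gaussian d]_z ((dotp a z + c) ^+ 2)%:E =
   (sig2 * dotp a a + c ^+ 2)%:E)%E.
Proof.
elim: d => [|d IH] in a c *.
  rewrite /= integral_dirac//=; last first.
    apply/measurable_EFinP/measurable_funX/measurable_funD => //.
    exact: measurable_fun_dotp.
  by rewrite diracT mul1e /dotp !big_ord0 mulr0 !add0r.
rewrite /= ge0_integral_distribution/=; last 2 first.
- apply/measurable_EFinP/measurable_funX/measurable_funD => //.
  exact: measurable_fun_dotp.
- by move=> z; rewrite lee_fin sqr_ge0.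
pose b : 'cV[R]_d := \col_i a (lift ord0 i) 0.
have ab (p : measurableTypeR R * 'cV[R]_d) :
    dotp a (cons_cV p) = a ord0 0 * p.1 + dotp b p.2.
  rewrite /dotp big_ord_recl; congr (_ + _).
    have e0 : (p.1%:M : 'M[R]_1) 0 0 = p.1 by rewrite mxE eqxx.
    congr (_ * _); rewrite -[RHS]e0 -[RHS](col_mxEu _ p.2).
    by congr (fun_of_matrix _ _ _); exact: val_inj.
  apply: eq_bigr => i _; have -> : b i 0 = a (lift ord0 i) 0 by rewrite mxE.
  congr (_ * _); rewrite -[RHS](col_mxEd (p.1%:M : 'M[R]_1)).
  by congr (fun_of_matrix _ _ _); exact: val_inj.
have aa : dotp a a = a ord0 0 ^+ 2 + dotp b b.
  rewrite /dotp big_ord_recl expr2; congr (_ + _).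
  by apply: eq_bigr => i _; rewrite /b !mxE.
rewrite (fubini_tonelli1 (fun p => ((dotp a (cons_cV p) + c) ^+ 2)%:E))/=; last 2 first.
- apply/measurable_EFinP/measurable_funX/measurable_funD => //.
  apply: measurable_fun_dotp => //; exact: measurable_cons_cV.
- by move=> p; rewrite lee_fin sqr_ge0.
(* The inner integral is the induction hypothesis with shift [a ord0 0 * x + c]. *)
rewrite (eq_integral (fun x : measurableTypeR R =>
  ((sig2 * dotp b b)%:E + ((a ord0 0 * x + c) ^+ 2)%:E)%E)); last first.
  move=> x _; rewrite /fubini_F/= -EFinD -IH; apply: eq_integral => z _.
  by rewrite ab/= addrAC [dotp b z + _]addrC.
rewrite ge0_integralD//=; last 3 first.
- by move=> x _; rewrite lee_fin mulr_ge0 ?dotp_ge0// ltW ?normal_var_gt0.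
- by move=> x _; rewrite lee_fin sqr_ge0.
- by apply/measurable_EFinP/measurable_funX/measurable_funD.
rewrite integral_cst_probability normal_integral_sqr aa -EFinD; congr EFin; ring.
Qed.

Lemma integrable_std_gaussian_dotp d (a : 'cV[R]_d) :
  (std_gaussian d).-integrable setT (fun z => (dotp a z)%:E).
Proof.
apply/integrableP; split; first by apply/measurable_EFinP; exact: measurable_fun_dotp.
apply: (@le_lt_trans _ _ (\int[std_gaussian d]_z
  (1 + ((dotp a z + 0) ^+ 2)%:E))%E).
  apply: ge0_le_integral => //.
  - by apply/measurable_EFinP/measurableT_comp => //; exact: measurable_fun_dotp.
  - apply/measurable_EFinP/measurable_funD => //; apply: measurable_funX.
    by apply: measurable_funD => //; exact: measurable_fun_dotp.
  - move=> z _; rewrite /= lee_fin addr0.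
    have [x0|x0] := ger0P (dotp a z); nra.
rewrite ge0_integralD//=; last 2 first.
- by move=> x _; rewrite lee_fin sqr_ge0.
- apply/measurable_EFinP/measurable_funX/measurable_funD => //.
  exact: measurable_fun_dotp.
by rewrite integral_cst_probability integral_std_gaussian_sqr -EFinD ltry.
Qed.

(* Polarization: both sides of [2 a.z = (a.z + 1)^2 - (a.z)^2 - 1] are integrated. *)
Lemma integral_std_gaussian_dotp d (a : 'cV[R]_d) :
  (\int[std_gaussian d]_z (dotp a z)%:E = 0)%E.
Proof.
have ia := integrable_std_gaussian_dotp a.
have i2 : (std_gaussian d).-integrable setT (fun z => ((dotp a z + 0) ^+ 2)%:E).
  apply/integrableP; split.
    apply/measurable_EFinP/measurable_funX/measurable_funD => //.
    exact: measurable_fun_dotp.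
  under eq_integral do rewrite gee0_abs ?lee_fin ?sqr_ge0//.
  by rewrite integral_std_gaussian_sqr ltry.
have i1 : (std_gaussian d).-integrable setT (fun z => (2 * dotp a z)%:E).
  under eq_fun do rewrite EFinM.
  exact: integrableZl.
have := integral_std_gaussian_sqr a 1.
rewrite (eq_integral (fun z => (((dotp a z + 0) ^+ 2)%:E +
   ((2 * dotp a z)%:E + 1%:E))%E)); last first.
  by move=> z _; rewrite -!EFinD; congr EFin; ring.
have ic : (std_gaussian d).-integrable setT (fun=> 1%:E : \bar R).
  exact: finite_measure_integrable_cst.
rewrite integralD//; last exact: integrableD.
rewrite integralD// integral_std_gaussian_sqr integral_cst_probability.
under eq_integral do rewrite EFinM.
rewrite integralZl//.
have /fineK <- : (\int[std_gaussian d]_z (dotp a z)%:E)%E \is a fin_num.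
  exact: integrable_fin_num.
by rewrite -EFinM -!EFinD => -[] ?; congr EFin; lra.
Qed.

Lemma Lnorm2_EFin d (T : measurableType d) (P : probability T R) (f : T -> R) (c : R) :
  (\int[P]_x (f x ^+ 2)%:E = c%:E)%E -> ('N[P]_2%:E[EFin \o f] = (Num.sqrt c)%:E)%E.
Proof.
move=> fc; rewrite unlock.
under eq_integral.
  move=> x _.
  have -> : (`|(EFin \o f) x| `^ 2 = (f x ^+ 2)%:E)%E.
    by rewrite /= powR_mulrn// -normrX ger0_norm ?sqr_ge0.
  over.
rewrite fc poweR_EFin -powR12_sqrt//.
rewrite -lee_fin -fc; apply: integral_ge0 => x _; by rewrite lee_fin sqr_ge0.
Qed.

End std_gaussian.

(** * Algebra of [C^(-1/2)] *)

Section isqrtmx.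
Context {R : realType} {d : nat} (C : 'M[R]_d) (hC : spdmx C).

Lemma spd_unitmx (A : 'M[R]_d) : spdmx A -> A \in unitmx.
Proof.
move=> [As Apos]; rewrite unitmxE unitfE; apply/det0P => -[v v0 vA].
have vT0 : v^T != 0 by apply: contra_neq v0 => vT; rewrite -[v]trmxK vT trmx0.
by have := Apos _ vT0; rewrite -As -trmx_mul vA trmx0 dotpE mulmx0 mxE ltxx.
Qed.

Lemma sqrtmxP : spdmx (sqrtmx C) /\ sqrtmx C *m sqrtmx C = C.
Proof. exact: (xgetPex 0 (spd_sqrt_exists hC)). Qed.

Lemma sqrtmx_unit : sqrtmx C \in unitmx.
Proof. by apply: spd_unitmx; case: sqrtmxP. Qed.

Lemma trmx_isqrtmx : (isqrtmx C)^T = isqrtmx C.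
Proof. by case: sqrtmxP => -[Ss _] _; rewrite /isqrtmx trmx_inv Ss. Qed.

Lemma isqrtmxK (z : 'cV[R]_d) : isqrtmx C *m (sqrtmx C *m z) = z.
Proof. by rewrite mulKmx// sqrtmx_unit. Qed.

Lemma invmx_isqrtmx : invmx C = isqrtmx C *m isqrtmx C.
Proof.
have Su := sqrtmx_unit; have Cu := spd_unitmx hC; have [_ SC] := sqrtmxP.
apply: (can_inj (mulKmx Cu)); rewrite mulmxV// -{1}SC mulmxA mulmxK//.
by rewrite mulmxV.
Qed.

Lemma isqrtmx_eq0 (v : 'cV[R]_d) : (isqrtmx C *m v == 0) = (v == 0).
Proof.
have Tu : isqrtmx C \in unitmx by rewrite unitmx_inv sqrtmx_unit.
apply/eqP/eqP => [Tv|->]; last by rewrite mulmx0.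
by rewrite -[v](mulKmx Tu) Tv mulmx0.
Qed.

Lemma dotp_invmx (x v : 'cV[R]_d) :
  dotp x (invmx C *m v) = dotp (isqrtmx C *m x) (isqrtmx C *m v).
Proof. by rewrite invmx_isqrtmx -mulmxA [LHS]dotp_mul trmx_isqrtmx. Qed.

End isqrtmx.

(** * Unit directions and residuals in the coordinates [C^(-1/2) x] *)

Section direction.
Context {R : realType} {d : nat} (C : 'M[R]_d) (hC : spdmx C).
Local Notation T := (isqrtmx C).
Implicit Types (x y v zeta : 'cV[R]_d).

(** The vector u. At [v = 0] the convention [0^-1 = 0] makes it the zero vector. *)
Definition direction v : 'cV[R]_d := (enorm (T *m v))^-1 *: (T *m v).

(** When u has norm 1, the orthogonal projection of [zeta] onto the complement of u; its mean over
    [v] is the vector b. *)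
Definition residual zeta v : 'cV[R]_d :=
  zeta - dotp zeta (direction v) *: direction v.

Lemma dotp_residual zeta v y : dotp (residual zeta v) y =
  dotp zeta y - dotp zeta (direction v) * dotp y (direction v).
Proof. by rewrite dotpC dotpBr dotpZr ![dotp y zeta]dotpC. Qed.

(** An inequality, so that it also covers the zero value; the bounds drawn from it then hold for
    every [v], on or off the sphere. *)
Lemma dotp_direction_le1 v : dotp (direction v) (direction v) <= 1.
Proof.
rewrite dotpZl dotpZr -sqr_enorm mulrA -expr2 exprVn.
have [->|e0] := eqVneq (enorm (T *m v)) 0; first by rewrite expr0n/= mulr0 ler01.
by rewrite mulVf// expf_neq0.
Qed.

Lemma sqr_dotp_direction_le zeta v : dotp zeta (direction v) ^+ 2 <= dotp zeta zeta.
Proof.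
apply: le_trans (CauchySchwarz_dotp _ _) _.
by rewrite ler_piMr ?dotp_ge0// dotp_direction_le1.
Qed.

(** The bound is uniform in [v] and thus gives integrability in [v]. Each of [zeta.y] and
    [(zeta.u)(y.u)] contributes at most half of it, by the arithmetic-geometric mean inequality. *)
Lemma dotp_residual_bound zeta v y :
  `|dotp (residual zeta v) y| <= dotp zeta zeta + dotp y y.
Proof.
rewrite dotp_residual.
have h1 := sqr_dotp_direction_le zeta v; have h2 := sqr_dotp_direction_le y v.
have := CauchySchwarz_dotp zeta y.
move: h1 h2 (dotp_ge0 zeta) (dotp_ge0 y).
move: (dotp zeta zeta) (dotp y y) (dotp zeta y) (dotp zeta _) (dotp y _).
move=> a b w s t sa tb a0 b0 wab.
have wab2 : w ^+ 2 <= ((a + b) / 2) ^+ 2 by have := sqr_ge0 (a - b); nra.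
have : `|w| <= (a + b) / 2.
  rewrite -(@ler_pXn2r _ 2)// ?nnegrE ?normr_ge0 ?divr_ge0 ?addr_ge0//.
  by rewrite real_normK ?num_real.
rewrite ler_norml => /andP[w1 w2].
have [st1 st2] : - (a + b) / 2 <= s * t /\ s * t <= (a + b) / 2.
  by have := sqr_ge0 (s - t); have := sqr_ge0 (s + t); split; nra.
by rewrite ler_norml; apply/andP; split; lra.
Qed.

Lemma measurable_direction : measurable_fun setT direction.
Proof.
have mT : measurable_fun setT (fun v : 'cV[R]_d => T *m v).
  exact: measurable_mulmx.
apply: measurable_fun_scalemx => //.
exact: (measurableT_comp (@measurable_invr R) (measurable_fun_enorm mT)).
Qed.

Lemma measurable_residual zeta : measurable_fun setT (residual zeta).
Proof.
apply: measurable_fun_addmx => //.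
under eq_fun do rewrite -scaleNr.
apply: measurable_fun_scalemx; last exact: measurable_direction.
apply: measurableT_comp => //; apply: measurable_fun_dotp => //.
exact: measurable_direction.
Qed.

End direction.

(** * Linear functions under the Hit-and-Run operator *)

Section line.
Context {R : realType} {d : nat} (C : 'M[R]_d) (hC : spdmx C).
Context (tau : probability 'cV[R]_d R).
Local Notation T := (isqrtmx C).
Implicit Types (x y v zeta : 'cV[R]_d).

Lemma bounded_integrable disp (X : measurableType disp) (P : probability X R)
    (f : X -> R) (M : R) : measurable_fun setT f -> (forall t, `|f t| <= M) ->
  P.-integrable setT (EFin \o f).
Proof.
move=> mf fM; apply: measurable_bounded_integrable => //.
  by rewrite [ltLHS]probability_setT ltry.
exists M; split; first exact: num_real.
by move=> r Mr t _; apply: le_trans (fM t) (ltW Mr).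
Qed.

Lemma measurable_usphere : measurable (usphere R d).
Proof.
rewrite (_ : usphere R d = @enorm R d @^-1` [set 1])//.
rewrite -[X in measurable X]setTI; apply: measurable_fun_enorm => //.
Qed.

Hypothesis htau : tau (usphere R d) = 1%E.

Lemma usphereC0 : tau (~` usphere R d) = 0%E.
Proof. by rewrite probability_setC ?htau ?subee//; exact: measurable_usphere. Qed.

Lemma integral_usphere (f : 'cV[R]_d -> \bar R) : tau.-integrable setT f ->
  (\int[tau]_(v in usphere R d) f v = \int[tau]_v f v)%E.
Proof.
move=> fi; rewrite [RHS](negligible_integral _ _ fi usphereC0)//; last first.
  by apply: measurableC; exact: measurable_usphere.
by rewrite setTD setCK.
Qed.

Lemma ge0_integral_usphere (f : 'cV[R]_d -> \bar R) : measurable_fun setT f ->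
  (forall v, 0 <= f v)%E ->
  (\int[tau]_(v in usphere R d) f v = \int[tau]_v f v)%E.
Proof.
move=> mf f0; rewrite [RHS](ge0_negligible_integral _ _ mf _ usphereC0)//; last first.
  by apply: measurableC; exact: measurable_usphere.
by rewrite setTD setCK.
Qed.

Lemma measurable_dotp_residual zeta y :
  measurable_fun setT (fun v => dotp (residual C zeta v) y).
Proof. by apply: measurable_fun_dotp => //; exact: measurable_residual. Qed.

Lemma integrable_dotp_residual zeta y :
  tau.-integrable setT (fun v => (dotp (residual C zeta v) y)%:E).
Proof.
apply: (@bounded_integrable _ _ tau (fun v => dotp (residual C zeta v) y)
  (dotp zeta zeta + dotp y y)).
  exact: measurable_dotp_residual.
by move=> v; exact: dotp_residual_bound.
Qed.

(** The vector b: a vector-valued expectation, taken coordinate by coordinate. *)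
Definition mean_residual zeta : 'cV[R]_d :=
  \col_i fine (\int[tau]_v (dotp (residual C zeta v) (delta_mx i 0))%:E)%E.

Lemma dotp_delta x i : dotp x (delta_mx i 0) = x i 0.
Proof.
rewrite /dotp (bigD1 i)//= mxE !eqxx mulr1 big1 ?addr0// => j /negbTE ji.
by rewrite mxE ji mulr0.
Qed.

Lemma integral_dotp_residual zeta y :
  (\int[tau]_v (dotp (residual C zeta v) y)%:E = (dotp (mean_residual zeta) y)%:E)%E.
Proof.
have ires i := integrable_dotp_residual zeta (delta_mx i 0).
rewrite (eq_integral (fun v => \sum_(i < d)
    ((y i 0)%:E * (dotp (residual C zeta v) (delta_mx i 0))%:E))%E); last first.
  move=> v _; rewrite sumEFin; congr EFin; apply: eq_bigr => i _.
  by rewrite dotp_delta mulrC.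
rewrite integral_sum//; last by move=> i; exact: integrableZl.
rewrite -sumEFin; apply: eq_bigr => i _; rewrite integralZl// mxE.
by rewrite [in RHS]mulrC EFinM fineK//; exact: integrable_fin_num.
Qed.

(** The quantity E(zeta . u)^2, whose infimum over unit [zeta] is [2 rho]. It is bounded by
    [|zeta|^2], so [fine] loses nothing. *)
Definition mean_sqr_direction zeta : R :=
  fine (\int[tau]_v (dotp zeta (direction C v) ^+ 2)%:E)%E.

Lemma integrable_sqr_direction zeta :
  tau.-integrable setT (fun v => (dotp zeta (direction C v) ^+ 2)%:E).
Proof.
apply: (@bounded_integrable _ _ tau (fun v => dotp zeta (direction C v) ^+ 2)
  (dotp zeta zeta)).
  by apply/measurable_funX/measurable_fun_dotp => //; exact: measurable_direction.
by move=> v; rewrite ger0_norm ?sqr_ge0// sqr_dotp_direction_le.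
Qed.

Lemma mean_sqr_directionE zeta :
  (\int[tau]_v (dotp zeta (direction C v) ^+ 2)%:E = (mean_sqr_direction zeta)%:E)%E.
Proof. by rewrite fineK//; exact: integrable_fin_num (integrable_sqr_direction _). Qed.

Lemma mean_sqr_direction_le zeta : mean_sqr_direction zeta <= dotp zeta zeta.
Proof.
rewrite -lee_fin -mean_sqr_directionE -[leRHS](integral_cst_probability tau).
apply: ge0_le_integral => //.
- by move=> v _; rewrite lee_fin sqr_ge0.
- exact: measurable_int (integrable_sqr_direction _).
- by move=> v _; rewrite lee_fin sqr_dotp_direction_le.
Qed.

Definition line_mean x v : R := - (dotp x (invmx C *m v) / enorm (T *m v) ^+ 2).

(** With [y = T x], the mean displacement along [T v] is [-(y.u) u]: on average the step erases the
    u-component of [y]. *)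
Lemma line_mean_residual zeta x v :
  dotp zeta (T *m x) + line_mean x v * dotp zeta (T *m v) =
  dotp (residual C zeta v) (T *m x).
Proof.
rewrite dotp_residual /line_mean dotp_invmx// /direction !dotpZr; congr (_ + _).
rewrite mulNr; congr (- _); rewrite expr2 invfM; ring.
Qed.

Lemma usphere_neq0 v : usphere R d v -> 0 < enorm (T *m v).
Proof.
move=> v1; rewrite lt_neqAle enorm_ge0 andbT eq_sym enorm_eq0 isqrtmx_eq0//.
by rewrite -enorm_eq0 v1 oner_eq0.
Qed.


Lemma measurable_line_mean x : measurable_fun setT (line_mean x).
Proof.
have mT : measurable_fun setT (fun v : 'cV[R]_d => T *m v).
  exact: measurable_mulmx.
apply: measurableT_comp => //; apply: measurable_funM.
  by apply: measurable_fun_dotp => //; exact: measurable_mulmx.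
apply: (measurableT_comp (@measurable_invr R)); apply: measurable_funX.
exact: measurable_fun_enorm.
Qed.

Lemma ghr_op_linear zeta x k :
  ghr_op C tau (fun x => dotp zeta (T *m x) * k) x =
  (dotp (mean_residual zeta) (T *m x) * k)%:E.
Proof.
rewrite /ghr_op (eq_integral (fun v =>
    (k%:E * (dotp (residual C zeta v) (T *m x))%:E)%E)); last first.
  (* On the sphere [T v] is nonzero, so [line_gaussian] has a positive standard deviation and the
     formula for affine integrands applies. *)
  move=> v /[!inE] v1; have e0 := usphere_neq0 v1.
  rewrite /line_gaussian -[X in normal_prob X]/(line_mean x v).
  rewrite (eq_integral (fun h : measurableTypeR R =>
      ((dotp zeta (T *m v) * k) * h + dotp zeta (T *m x) * k)%:E)); last first.
    move=> h _; rewrite mulmxDr dotpDr -scalemxAr dotpZr; congr EFin; ring.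
  rewrite integral_normal_prob_linear ?invr_gt0// -EFinM -line_mean_residual.
  by rewrite -[X in _ * X + _]/(line_mean x v); congr EFin; ring.
rewrite integral_usphere; last exact: integrableZl (integrable_dotp_residual _ _).
rewrite integralZl//; last exact: integrable_dotp_residual.
by rewrite integral_dotp_residual -EFinM mulrC.
Qed.

Lemma dotp_mean_residual zeta :
  dotp (mean_residual zeta) zeta = dotp zeta zeta - mean_sqr_direction zeta.
Proof.
apply: EFin_inj; rewrite -integral_dotp_residual.
rewrite (eq_integral (fun v => ((dotp zeta zeta)%:E -
    (dotp zeta (direction C v) ^+ 2)%:E)%E)); last first.
  by move=> v _; rewrite dotp_residual -EFinB expr2.
rewrite integralB//; last 2 first.
- exact: finite_measure_integrable_cst.
- exact: integrable_sqr_direction.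
by rewrite integral_cst_probability mean_sqr_directionE -EFinB.
Qed.

(** Under [x = C^(1/2) z] the function is a multiple of [zeta.z], with second moment known up to
    [normal_var]; the divisor cancels that factor. *)
Lemma Lnorm2_gaussian_linear zeta :
  ('N[gaussian C]_2%:E[EFin \o fun x =>
      (dotp zeta (T *m x) / Num.sqrt (@normal_var R))%R] =
   (enorm zeta)%:E)%E.
Proof.
have s0 := @normal_var_gt0 R; set k := Num.sqrt _.
have k0 : k != 0 by rewrite gt_eqF// sqrtr_gt0.
rewrite (Lnorm2_EFin (c := dotp zeta zeta))//.
rewrite ge0_integral_distribution//=; last 2 first.
- apply/measurable_EFinP/measurable_funX/measurable_funM => //.
  by apply: measurable_fun_dotp => //; exact: measurable_mulmx.
- by move=> x; rewrite lee_fin sqr_ge0.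
rewrite (eq_integral (fun z => ((k ^- 2)%:E * ((dotp zeta z + 0) ^+ 2)%:E)%E)); last first.
  by move=> z _; rewrite isqrtmxK// -EFinM addr0 exprMn exprVn mulrC.
rewrite ge0_integralZl//=; last 3 first.
- apply/measurable_EFinP/measurable_funX/measurable_funD => //.
  exact: measurable_fun_dotp.
- by move=> z _; rewrite lee_fin sqr_ge0.
- by rewrite lee_fin invr_ge0 sqr_ge0.
rewrite integral_std_gaussian_sqr -EFinM expr0n addr0 sqr_sqrtr ?(ltW s0)//.
by rewrite mulrA mulVf ?mul1r// gt_eqF.
Qed.

Lemma lambda_le_mean_sqr_direction zeta : enorm zeta = 1 ->
  (lambda C tau <= (mean_sqr_direction zeta)%:E)%E.
Proof.
move=> z1; have zz : dotp zeta zeta = 1 by rewrite -sqr_enorm z1 expr1n.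
pose f x := dotp zeta (T *m x) / Num.sqrt (@normal_var R).
have mf : measurable_fun setT f.
  apply: measurable_funM => //.
  by apply: measurable_fun_dotp => //; exact: measurable_mulmx.
have f1 : ('N[gaussian C]_2%:E[EFin \o f] = 1)%E.
  by rewrite Lnorm2_gaussian_linear z1.
have pif : ('N[gaussian C]_2%:E[ghr_op C tau f] = (enorm (mean_residual zeta))%:E)%E.
  rewrite -Lnorm2_gaussian_linear; congr Lnorm; apply/funext => x.
  exact: ghr_op_linear.
(* The supremum is bounded below by the value at the single test function [f]. *)
suff : ((1 - mean_sqr_direction zeta)%:E <= ereal_sup
    [set 'N[gaussian C]_2%:E[ghr_op C tau f] | f in
    [set f | [/\ f \in Lfun (gaussian C) 2%:E,
                 (\int[gaussian C]_x (f x)%:E = 0)%E &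
                 ('N[gaussian C]_2%:E[EFin \o f] = 1)%E]]])%E.
  move=> h; rewrite /lambda; apply: le_trans (leeB (lexx _) h) _.
  by rewrite -EFinB lee_fin; lra.
apply: le_trans (ereal_sup_ubound _); last first.
  exists f; last exact: pif.
  split => //.
    have fy : ('N[gaussian C]_2%:E[EFin \o f] < +oo)%E by rewrite f1 ltry.
    by rewrite inE; apply/andP; split; rewrite inE//; exact: fy.
  rewrite integral_distribution//=; last 2 first.
  - exact/measurable_EFinP.
  - under [X in _.-integrable _ X]eq_fun do rewrite /= /f isqrtmxK// EFinM.
    exact: integrableZr (integrable_std_gaussian_dotp zeta).
  under eq_integral do rewrite /f isqrtmxK// EFinM.
  rewrite integralZr//; last exact: integrable_std_gaussian_dotp.
  by rewrite integral_std_gaussian_dotp mul0e.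
(* What remains is [b.zeta <= |b|], Cauchy-Schwarz with a unit vector. *)
rewrite lee_fin -zz -dotp_mean_residual.
have := CauchySchwarz_dotp (mean_residual zeta) zeta.
rewrite zz mulr1 -sqr_enorm => h; apply: le_trans (ler_norm _) _.
by rewrite -(@ler_pXn2r _ 2)// ?nnegrE ?enorm_ge0// real_normK ?num_real.
Qed.

End line.

(** * Wasserstein lower bound *)

Section wasserstein_bound.
Context {R : realType} {d : nat} (C : 'M[R]_d) (hC : spdmx C).
Context (tau : probability 'cV[R]_d R) (htau : tau (usphere R d) = 1%E).
Local Notation T := (isqrtmx C).
Local Notation N01 := (@normal_prob R 0 1).
Implicit Types (x y v zeta : 'cV[R]_d).

(** One move driven by a direction [p.1] and an independent standard normal [p.2]. It exhibits the
    kernel as an image of a product measure, to which Fubini and change of variables apply. *)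
Definition ghr_step x (p : 'cV[R]_d * measurableTypeR R) : 'cV[R]_d :=
  x + affine (line_mean C x p.1) (enorm (T *m p.1))^-1 p.2 *: p.1.

Lemma measurable_ghr_step x : measurable_fun setT (ghr_step x).
Proof.
apply: measurable_fun_addmx => //.
apply: measurable_fun_scalemx; last exact: measurable_fst.
apply: measurable_funD.
  exact: (measurableT_comp (measurable_line_mean C x) measurable_fst).
apply: measurable_funM; last exact: measurable_snd.
apply: (measurableT_comp (@measurable_invr R)); apply: measurable_fun_enorm.
exact: (measurableT_comp (measurable_mulmx _) measurable_fst).
Qed.

HB.instance Definition _ x :=
  isMeasurableFun.Build _ _ _ _ (ghr_step x) (measurable_ghr_step x).

Lemma ghr_kernel_distribution x (A : set 'cV[R]_d) : measurable A ->
  ghr_kernel C tau x A = distribution (tau \x N01)%E (ghr_step x) A.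
Proof.
move=> mA; rewrite /distribution /pushforward /= /product_measure1/=.
have mB : measurable (ghr_step x @^-1` A).
  by rewrite -[X in measurable X]setTI; exact: measurable_ghr_step.
rewrite -(ge0_integral_usphere htau)//=; last first.
  exact: measurable_fun_xsection.
apply: eq_integral => v /[!inE] v1; have e0 := usphere_neq0 hC v1.
pose B : set (measurableTypeR R) := [set h | A (x + h *: v)].
have mline : measurable_fun setT (fun h : measurableTypeR R => x + h *: v).
  by apply: measurable_fun_addmx => //; exact: measurable_fun_scalemx.
have mBv : measurable B.
  by rewrite -[X in measurable X]setTI; exact: mline.
rewrite (eq_integral (fun h : measurableTypeR R => (\1_B h)%:E)); last first.
  by move=> h _; rewrite /= !indicE.
rewrite integral_indic// setIT [LHS]normal_prob_affine ?invr_gt0//.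
rewrite /distribution /pushforward; congr (_ _).
by apply/seteqP; split => z /=; rewrite /xsection/= inE.
Qed.

Lemma dotp_ghr_step zeta x p : dotp zeta (T *m ghr_step x p) =
  dotp (residual C zeta p.1) (T *m x) + p.2 * dotp zeta (direction C p.1).
Proof.
rewrite /ghr_step mulmxDr dotpDr -scalemxAr dotpZr -line_mean_residual// /affine.
by rewrite [direction C _]/direction dotpZr; ring.
Qed.

Lemma measurable_dotp_ghr_step zeta x :
  measurable_fun setT (fun p => dotp zeta (T *m ghr_step x p)).
Proof.
apply: measurable_fun_dotp => //; apply: measurable_fun_mulmx.
exact: measurable_ghr_step.
Qed.

(** Since [|t| <= 1 + t^2], it suffices to bound the second moment in the normal variable uniformly
    in the direction. *)
Lemma integrable_dotp_ghr_step zeta x :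
  (tau \x N01)%E.-integrable setT (fun p => (dotp zeta (T *m ghr_step x p))%:E).
Proof.
pose s := @normal_var R; pose M : R := dotp zeta zeta + dotp (T *m x) (T *m x).
have mf := measurable_dotp_ghr_step zeta x.
apply/integrable12ltyP; first exact/measurable_EFinP.
(* The slope in [z] is [zeta.u], with square at most [zeta.zeta], and the intercept is a residual
   term, at most [M] in absolute value. *)
apply: (@le_lt_trans _ _ (\int[tau]_v (1 + (dotp zeta zeta * s + M ^+ 2))%:E)%E);
  last by rewrite integral_cst_probability ltry.
apply: ge0_le_integral => //.
- by move=> v _; apply: integral_ge0.
- apply: (measurable_fun_fubini_tonelli_F
    (fun p => `|(dotp zeta (T *m ghr_step x p))%:E|%E)) => //.
  by apply/measurableT_comp => //; exact/measurable_EFinP.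
move=> v _; pose a := dotp zeta (direction C v).
pose b := dotp (residual C zeta v) (T *m x).
apply: (@le_trans _ _ (\int[N01]_(z in [set: measurableTypeR R])
   (1%:E + ((a * z + b) ^+ 2)%:E))%E).
  apply: ge0_le_integral => //.
  - apply/measurable_EFinP/measurableT_comp => //.
    exact: (measurableT_comp mf (measurable_pair1 v)).
  - apply/measurable_EFinP/measurable_funD => //; apply: measurable_funX.
    by apply: measurable_funD => //; exact: measurable_funM.
  move=> z _; rewrite dotp_ghr_step/= -/a -/b lee_fin [z * a]mulrC [b + _]addrC.
  by move: (a * z + b) => t; have [h|h] := ger0P t; nra.
rewrite ge0_integralD//=; last 2 first.
- by move=> z _; rewrite lee_fin sqr_ge0.
- apply/measurable_EFinP/measurable_funX/measurable_funD => //.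
rewrite integral_cst_probability normal_integral_sqr -EFinD lee_fin lerD2l lerD//.
  by rewrite ler_wpM2r ?sqr_dotp_direction_le// ltW ?normal_var_gt0.
rewrite -(real_normK (num_real b)) ler_pXn2r ?nnegrE ?normr_ge0//.
  exact: dotp_residual_bound.
by rewrite addr_ge0 ?dotp_ge0.
Qed.

Lemma integral_dotp_ghr_step zeta x :
  (\int[tau \x N01]_p (dotp zeta (T *m ghr_step x p))%:E =
   (dotp (mean_residual C tau zeta) (T *m x))%:E)%E.
Proof.
rewrite -integral12_prod_meas1; last exact: integrable_dotp_ghr_step.
rewrite -integral_dotp_residual; apply: eq_integral => v _; rewrite /fubini_F.
under eq_integral do rewrite dotp_ghr_step/= addrC mulrC.
exact: normal_integral_linear.
Qed.

(** Meant for [g] either projection of a coupling: the marginal condition says that [g] has the law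
    of [ghr_step x], so integrals of linear functions transfer. *)
Lemma integral_coupling (P : probability ('cV[R]_d * 'cV[R]_d)%type R) zeta x
    (g : 'cV[R]_d * 'cV[R]_d -> 'cV[R]_d) : measurable_fun setT g ->
  (forall A, measurable A -> P (g @^-1` A) = ghr_kernel C tau x A) ->
  P.-integrable setT (fun p => (dotp zeta (T *m g p))%:E) /\
  (\int[P]_p (dotp zeta (T *m g p))%:E =
    (dotp (mean_residual C tau zeta) (T *m x))%:E)%E.
Proof.
move=> mg Pg.
pose G : {mfun ('cV[R]_d * 'cV[R]_d)%type >-> 'cV[R]_d} :=
  HB.pack g (isMeasurableFun.Build _ _ _ _ g mg).
have PgE A : measurable A ->
    distribution P G A = distribution (tau \x N01)%E (ghr_step x) A.
  by move=> mA; rewrite -ghr_kernel_distribution// -Pg.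
have ml : measurable_fun setT (fun y => (dotp zeta (T *m y))%:E).
  apply/measurable_EFinP/measurable_fun_dotp => //; exact: measurable_mulmx.
have ig : P.-integrable setT (fun p => (dotp zeta (T *m g p))%:E).
  apply/integrableP; split.
    exact: (measurableT_comp ml mg).
  have /integrableP[_] := integrable_dotp_ghr_step zeta x.
  rewrite -(ge0_integral_distribution (ghr_step x)
    (f := fun y => `|(dotp zeta (T *m y))%:E|%E))//;
    last exact: measurableT_comp.
  rewrite -(ge0_integral_distribution G
    (f := fun y => `|(dotp zeta (T *m y))%:E|%E))//;
    last exact: measurableT_comp.
  rewrite [X in (X < _)%E -> _](eq_measure_integral (distribution P G))//.
  by move=> A mA _; exact/esym/PgE.
split => //; rewrite -integral_dotp_ghr_step.
rewrite -(integral_distribution (X := G) (f := fun y => (dotp zeta (T *m y))%:E))//.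
rewrite -(integral_distribution (X := ghr_step x)
  (f := fun y => (dotp zeta (T *m y))%:E))//.
  by apply: eq_measure_integral => A mA _; exact: PgE.
exact: integrable_dotp_ghr_step.
Qed.


(** Jensen in tangent-line form: [t^2 >= 2 c t - c^2] for [t = zeta . T (p.1 - p.2)]. Its mean is
    [c], so integration gives [c^2], and Cauchy-Schwarz bounds [t^2] by the cost. *)
Lemma coupling_lower_bound (P : probability ('cV[R]_d * 'cV[R]_d)%type R) zeta :
  enorm zeta = 1 ->
  coupling (ghr_kernel C tau (sqrtmx C *m zeta)) (ghr_kernel C tau 0) P ->
  (((1 - mean_sqr_direction C tau zeta) ^+ 2)%:E <=
   'E_P[fun p => (enorm (T *m (p.1 - p.2)) ^+ 2)%R])%E.
Proof.
move=> z1 Pc; have zz : dotp zeta zeta = 1 by rewrite -sqr_enorm z1 expr1n.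
set c := 1 - _.
have [i1 E1] := @integral_coupling P zeta _ _ measurable_fst (fun A mA => (Pc A mA).1).
have [i2 E2] := @integral_coupling P zeta _ _ measurable_snd (fun A mA => (Pc A mA).2).
(* As [T (C^(1/2) zeta) = zeta], the first marginal has mean [b.zeta = c]; the second, started at 0,
   has mean 0. *)
rewrite isqrtmxK// dotp_mean_residual// zz -/c in E1.
rewrite mulmx0 dotpE mulmx0 mxE in E2.
rewrite unlock.
have mW : measurable_fun setT (fun p : 'cV[R]_d * 'cV[R]_d =>
    enorm (T *m (p.1 - p.2)) ^+ 2).
  apply: measurable_funX; apply: measurable_fun_enorm.
  apply: measurable_fun_mulmx; apply: measurable_fun_addmx; first exact: measurable_fst.
  under eq_fun do rewrite -scaleN1r.
  by apply: measurable_fun_scalemx => //; exact: measurable_snd.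
have W0 : (0 <= \int[P]_p (enorm (T *m (p.1 - p.2)) ^+ 2)%:E)%E.
  by apply: integral_ge0 => p _; rewrite lee_fin sqr_ge0.
(* An infinite cost makes the bound trivial; a finite one makes the cost integrable, so that
   integrals can be compared. *)
have [->|Wfin] := eqVneq (\int[P]_p (enorm (T *m (p.1 - p.2)) ^+ 2)%:E)%E +oo%E.
  by rewrite leey.
have iW : P.-integrable setT (fun p => (enorm (T *m (p.1 - p.2)) ^+ 2)%:E).
  apply/integrableP; split; first exact/measurable_EFinP.
  under eq_integral do rewrite gee0_abs ?lee_fin ?sqr_ge0//.
  by rewrite ltey.
have il : P.-integrable setT (fun p => ((2 * c)%:E * ((dotp zeta (T *m p.1))%:E -
    (dotp zeta (T *m p.2))%:E) - (c ^+ 2)%:E)%E).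
  apply: integrableB => //; last exact: finite_measure_integrable_cst.
  by apply: integrableZl => //; exact: integrableB.
apply: le_trans (le_integral _ il iW _) => //.
  rewrite integralB//; last 2 first.
  - by apply: integrableZl => //; exact: integrableB.
  - exact: finite_measure_integrable_cst.
  rewrite integralZl//; last exact: integrableB.
  rewrite integralB// E1 E2 integral_cst_probability sube0 -EFinM -EFinB lee_fin.
  by rewrite le_eqVlt; apply/orP; left; apply/eqP; ring.
move=> p _ /=; rewrite [leLHS](_ : _ = (2 * c * (dotp zeta (T *m p.1) -
  dotp zeta (T *m p.2)) - c ^+ 2)%:E)// lee_fin sqr_enorm.
have := CauchySchwarz_dotp zeta (T *m (p.1 - p.2)); rewrite zz mul1r.
apply: le_trans; rewrite mulmxBr dotpBr.
move: (dotp zeta _ - dotp zeta _) => t; have := sqr_ge0 (t - c); nra.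
Qed.

Lemma contraction_rate_le_mean_sqr_direction (r : R) zeta : enorm zeta = 1 ->
  (forall x y, (wasserstein2 T (ghr_kernel C tau x) (ghr_kernel C tau y) <=
    ((1 - r) * enorm (T *m (x - y)))%:E)%E) ->
  r <= mean_sqr_direction C tau zeta.
Proof.
(* The points [C^(1/2) zeta] and 0 are at distance [|zeta| = 1], so the hypothesis bounds their
   Wasserstein distance by [1 - r]. *)
move=> z1 /(_ (sqrtmx C *m zeta) 0); rewrite subr0 isqrtmxK// z1 mulr1 => W.
(* This makes [1 - mean_sqr_direction C tau zeta] nonnegative, hence the square root of its own
   square. *)
have q1 : mean_sqr_direction C tau zeta <= 1.
  by rewrite -[leRHS](expr1n R 2) -z1 sqr_enorm mean_sqr_direction_le.
suff : ((1 - mean_sqr_direction C tau zeta)%:E <= (1 - r)%:E)%E.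
  by rewrite lee_fin; lra.
apply: le_trans W; rewrite /wasserstein2.
have -> : (1 - mean_sqr_direction C tau zeta)%:E =
    (((1 - mean_sqr_direction C tau zeta) ^+ 2)%:E `^ 2^-1)%E.
  by rewrite poweR_EFin powR12_sqrt ?sqr_ge0// sqrtr_sqr ger0_norm// subr_ge0.
have lb : (((1 - mean_sqr_direction C tau zeta) ^+ 2)%:E <= ereal_inf
    [set 'E_P[fun p => (enorm (T *m (p.1 - p.2)) ^+ 2)%R] | P in
      coupling (ghr_kernel C tau (sqrtmx C *m zeta)) (ghr_kernel C tau 0)])%E.
  by apply/ereal_infP => _ [P Pc <-]; exact: coupling_lower_bound.
apply: gt0_ler_poweR => //.
  by rewrite in_itv/= lee_fin sqr_ge0 leey.
by rewrite in_itv/= leey andbT; apply: le_trans lb; rewrite lee_fin sqr_ge0.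
Qed.

End wasserstein_bound.

(** * From unit vectors to the infimum *)

Theorem lemma3 (R : realType) (d : nat) (C : 'M[R]_d) (hC : spdmx C)
    (tau : probability 'cV[R]_d R) (htau : tau (usphere R d) = 1%E) :
  (lambda C tau <= 3%:E * rho C tau)%E /\
  forall rho' : R, 0 < rho' ->
    (forall x y : 'cV[R]_d,
       (wasserstein2 (isqrtmx C) (ghr_kernel C tau x) (ghr_kernel C tau y) <=
        ((1 - rho') * enorm (isqrtmx C *m (x - y)))%:E)%E) ->
    (rho'%:E <= 3%:E * rho C tau)%E.
Proof.
(* Both claims bound a number by E(zeta . u)^2 for every unit [zeta], hence by the infimum
   [I = 2 rho]. *)
suff rho_lb (r : \bar R) :
    (forall zeta, enorm zeta = 1 -> (r <= (mean_sqr_direction C tau zeta)%:E)%E) ->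
    (r <= 3%:E * rho C tau)%E.
  split; first by apply: rho_lb => zeta; exact: lambda_le_mean_sqr_direction.
  move=> rho' _ W; apply: rho_lb => zeta z1; rewrite lee_fin.
  exact: (contraction_rate_le_mean_sqr_direction hC htau z1 W).
move=> rq; rewrite /rho; set I := ereal_inf _.
have IE zeta : ('E_tau[fun v => (dotp zeta
    ((enorm (isqrtmx C *m v))^-1 *: (isqrtmx C *m v)) ^+ 2)%R] =
    (mean_sqr_direction C tau zeta)%:E)%E.
  by rewrite unlock -mean_sqr_directionE.
have rI : (r <= I)%E by apply/ereal_infP => _ [zeta z1 <-]; rewrite IE; exact: rq.
(* Nonnegativity gives [I <= (3/2) I = 3 rho]. *)
have I0 : (0 <= I)%E.
  apply/ereal_infP => _ [zeta z1 <-]; rewrite unlock.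
  by apply: integral_ge0 => v _; rewrite lee_fin sqr_ge0.
apply: le_trans rI _; rewrite muleA -EFinM; move: I0; case: I => [i| |]//.
  by rewrite -EFinM !lee_fin => i0; lra.
by move=> _; rewrite gt0_muley ?lte_fin.
Qed.
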